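(* Let $\mathsf{V}$ be a structurally complete congruence meet-semidistributive variety of finite type generated by finite algebras. Then $\mathsf{V}$ is strongly structurally complete if and only if $\mathsf{V}$ has a finite residual bound.
   Context: Finite type means finitely many operation symbols. A variety is generated by finite algebras if it is the smallest variety containing some class of finite algebras. A variety is congruence meet-semidistributive if the congruence lattice of each of its members satisfies: $\alpha\wedge\beta=\alpha\wedge\gamma$ implies $\alpha\wedge\beta=\alpha\wedge(\beta\vee\gamma)$. A variety has a finite residual bound if there is $m<\omega$ such that every subdirectly irreducible member has cardinality less than $m$. $\mathbf{Q}(\mathsf{K})$ is the smallest quasivariety containing $\mathsf{K}$, and $\mathbf{P}(\mathsf{K})$ is the smallest prevariety (class closed under isomorphic copies, subalgebras and direct products, including the empty product) containing $\mathsf{K}$. $\mathbf{F}_{\mathsf{V}}(\omega)$ is the $\mathsf{V}$-free algebra of rank $\omega$. A variety $\mathsf{V}$ is structurally complete if $\mathsf{V}=\mathbf{Q}(\mathbf{F}_{\mathsf{V}}(\omega))$, and strongly structurally complete if $\mathsf{V}=\mathbf{P}(\mathbf{F}_{\mathsf{V}}(\omega))$. *)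

(* Defs.v *)
From Stdlib Require List.
From HB Require Import structures.
From mathcomp Require Import all_boot all_order.
From mathcomp Require Import boolp classical_sets functions cardinality.

Set Implicit Arguments.
Unset Strict Implicit.
Unset Printing Implicit Defensive.

Import Order.TTheory.

Local Open Scope classical_set_scope.
Local Open Scope card_scope.

Record signature := Signature {
  symbol :> Type;
  arity : symbol -> nat
}.

Definition finite_type (S : signature) : Prop := finite_set [set: symbol S].

(* Algebras are nonempty, as usual in universal algebra. *)
Record algebra (S : signature) := Algebra {
  carrier :> Type;
  op : forall f : S, ('I_(arity f) -> carrier) -> carrier;
  carrier_nonempty : inhabited carrier
}.
Arguments op {S} _ f _.

Definition finite_algebra (S : signature) (A : algebra S) : Prop :=
  finite_set [set: A].

Section Constructions.
Variable S : signature.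
Implicit Types A B : algebra S.

Definition is_hom A B (h : A -> B) : Prop :=
  forall (f : S) (a : 'I_(arity f) -> A),
    h (op A f a) = op B f (fun k => h (a k)).

Definition isomorphic A B : Prop :=
  exists2 h : A -> B, is_hom h & bijective h.

Record subuniverse A := Subuniverse {
  in_sub :> A -> Prop;
  sub_op : forall (f : S) (a : 'I_(arity f) -> A),
    (forall k, in_sub (a k)) -> in_sub (op A f a);
  sub_nonempty : exists x, in_sub x
}.

Lemma subalg_nonempty A (U : subuniverse A) : inhabited {x : A | U x}.
Proof. by have [x Ux] := sub_nonempty U; exact: (inhabits (exist _ x Ux)). Qed.

Definition subalg A (U : subuniverse A) : algebra S :=
  {| carrier := {x : A | U x};
     op f a := exist _ (op A f (fun k => sval (a k)))
                       (sub_op (fun k => svalP (a k)));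
     carrier_nonempty := subalg_nonempty U |}.

Lemma prod_alg_nonempty (I : Type) (B : I -> algebra S) :
  inhabited (forall i, B i).
Proof.
have c i : B i.
  by have /cid[x _] : exists x : B i, True by case: (carrier_nonempty (B i)) => x; exists x.
exact: (inhabits c).
Qed.

Definition prod_alg (I : Type) (B : I -> algebra S) : algebra S :=
  {| carrier := forall i, B i;
     op f a := fun i => op (B i) f (fun k => a k i);
     carrier_nonempty := prod_alg_nonempty B |}.

Definition subdirect_embedding A (I : Type) (B : I -> algebra S)
    (h : A -> prod_alg B) : Prop :=
  [/\ is_hom h, injective h & forall i (y : B i), exists x, h x i = y].

Definition subdirectly_irreducible A : Prop :=
  forall (I : Type) (B : I -> algebra S) (h : A -> prod_alg B),
    subdirect_embedding h -> exists i, bijective (fun x => h x i).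

End Constructions.

Fact cong_display : Order.disp_t. Proof. exact: Order.Disp tt tt. Qed.

Section Congruences.
Variables (S : signature) (A : algebra S).

Record congruence := Congruence {
  cong_rel :> A -> A -> Prop;
  cong_refl : forall x, cong_rel x x;
  cong_sym : forall x y, cong_rel x y -> cong_rel y x;
  cong_trans : forall x y z, cong_rel x y -> cong_rel y z -> cong_rel x z;
  cong_op : forall (f : S) (a b : 'I_(arity f) -> A),
    (forall k, cong_rel (a k) (b k)) -> cong_rel (op A f a) (op A f b)
}.

Lemma cong_ext (r s : congruence) : (forall x y, r x y <-> s x y) -> r = s.
Proof.
case: r s => [r r1 r2 r3 r4] [s s1 s2 s3 s4] /= rs.
have e : r = s by apply/funext => x; apply/funext => y; apply/propext.
by subst s; congr Congruence; exact: Prop_irrelevance.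
Qed.

Definition cong_sub (r s : congruence) : Prop := forall x y, r x y -> s x y.

Definition cong_le (r s : congruence) : bool := `[< cong_sub r s >].

Program Definition cong_meet (r s : congruence) : congruence :=
  {| cong_rel x y := r x y /\ s x y |}.
Next Obligation. by split; exact: cong_refl. Qed.
Next Obligation. by split; exact: cong_sym. Qed.
Next Obligation. by split; [exact: (cong_trans (y := y))|exact: (cong_trans (y := y))]. Qed.
Next Obligation. by split; apply: cong_op => k; case: (H k). Qed.

Program Definition cong_join (r s : congruence) : congruence :=
  {| cong_rel x y := forall t, cong_sub r t -> cong_sub s t -> t x y |}.
Next Obligation. exact: cong_refl. Qed.
Next Obligation. by apply: cong_sym; exact: H. Qed.
Next Obligation. by apply: (cong_trans (y := y)); [exact: H|exact: H0]. Qed.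
Next Obligation. by apply: cong_op => k; exact: H. Qed.

Lemma cong_le_refl : reflexive cong_le.
Proof. by move=> r; apply/asboolP => x y. Qed.

Lemma cong_le_anti : antisymmetric cong_le.
Proof.
move=> r s /andP[/asboolP rs /asboolP sr].
by apply: cong_ext => x y; split; [exact: rs|exact: sr].
Qed.

Lemma cong_le_trans : transitive cong_le.
Proof.
move=> s r t /asboolP rs /asboolP st; apply/asboolP => x y rxy.
exact/st/rs.
Qed.

HB.instance Definition _ := gen_eqMixin congruence.
HB.instance Definition _ := gen_choiceMixin congruence.
HB.instance Definition _ := Order.Le_isPOrder.Build cong_display congruence
  cong_le_refl cong_le_anti cong_le_trans.

Lemma cong_leIP (r s t : congruence) :
  (r <= cong_meet s t)%O = (r <= s)%O && (r <= t)%O.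
Proof.
apply/asboolP/andP => [h|[/asboolP rs /asboolP rt] x y rxy].
  by split; apply/asboolP => x y /h[].
by split; [exact: rs|exact: rt].
Qed.

Lemma cong_leUP (r s t : congruence) :
  (cong_join r s <= t)%O = (r <= t)%O && (s <= t)%O.
Proof.
apply/asboolP/andP => [h|[/asboolP rt /asboolP st] x y]; last exact.
by split; apply/asboolP => x y xy; apply: h => u ru su; [exact: ru|exact: su].
Qed.

HB.instance Definition _ :=
  Order.POrder_MeetJoin_isLattice.Build cong_display congruence
    cong_leIP cong_leUP.

End Congruences.

Definition meet_semidistributive (d : Order.disp_t) (L : latticeType d) : Prop :=
  forall a b c : L, (a `&` b = a `&` c -> a `&` b = a `&` (b `|` c))%O.

Section Terms.
Variable S : signature.

Inductive term (X : Type) : Type :=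
| Var of X
| App (f : S) of ('I_(arity f) -> term X).

Fixpoint eval (X : Type) (A : algebra S) (v : X -> A) (t : term X) : A :=
  match t with
  | Var x => v x
  | App f ts => op A f (fun k => eval v (ts k))
  end.

Definition identity : Type := (term nat * term nat)%type.

Definition quasi_identity : Type := (seq identity * identity)%type.

Definition sat_at (A : algebra S) (v : nat -> A) (e : identity) : Prop :=
  eval v e.1 = eval v e.2.

Definition sat_identity (A : algebra S) (e : identity) : Prop :=
  forall v : nat -> A, sat_at v e.

Definition sat_quasi_identity (A : algebra S) (q : quasi_identity) : Prop :=
  forall v : nat -> A, (forall e, List.In e q.1 -> sat_at v e) -> sat_at v q.2.

End Terms.

Section Classes.
Variable S : signature.
Implicit Types K C V : algebra S -> Prop.

Definition variety C : Prop :=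
  exists E : identity S -> Prop,
    forall A, C A <-> (forall e, E e -> sat_identity A e).

Definition quasivariety C : Prop :=
  exists E : quasi_identity S -> Prop,
    forall A, C A <-> (forall q, E q -> sat_quasi_identity A q).

Definition prevariety C : Prop :=
  [/\ forall A B, isomorphic A B -> C A -> C B,
      forall A (U : subuniverse A), C A -> C (subalg U) &
      forall (I : Type) (B : I -> algebra S),
        (forall i, C (B i)) -> C (prod_alg B)].

Definition smallest_containing (P : (algebra S -> Prop) -> Prop) K A : Prop :=
  forall C, P C -> (forall B, K B -> C B) -> C A.

Definition variety_of K := smallest_containing variety K.
Definition quasivariety_of K := smallest_containing quasivariety K.
Definition prevariety_of K := smallest_containing prevariety K.

Definition generated_by_finite_algebras V : Prop :=
  exists K, (forall A, K A -> finite_algebra A) /\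
            (forall A, V A <-> variety_of K A).

Definition congruence_meet_semidistributive V : Prop :=
  forall A, V A -> meet_semidistributive (congruence A).

Definition has_finite_residual_bound V : Prop :=
  exists m : nat, forall A, V A -> subdirectly_irreducible A ->
    exists2 n, (n < m)%N & [set: A] #= `I_n.

End Classes.

Section FreeAlgebra.
Variables (S : signature) (V : algebra S -> Prop).

Definition free_eq (s t : term S nat) : Prop :=
  forall A, V A -> sat_identity A (s, t).

(* The V-free algebra of rank omega is the quotient of the algebra of terms in
   omega variables by the identities of V: an element is an equivalence class of
   terms, given as a predicate, and [free_repr] chooses a term in a class. *)
Definition free_carrier : Type :=
  {c : term S nat -> Prop | exists t, c = free_eq t}.

Definition free_class (t : term S nat) : free_carrier :=
  exist _ (free_eq t) (ex_intro _ t erefl).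

Definition free_repr (c : free_carrier) : term S nat := sval (cid (svalP c)).

Definition free_alg : algebra S :=
  {| carrier := free_carrier;
     op f a := free_class (App (fun k => free_repr (a k)));
     carrier_nonempty := inhabits (free_class (Var S 0)) |}.

Lemma free_classP (s t : term S nat) :
  free_class s = free_class t <-> free_eq s t.
Proof.
split=> [/(congr1 sval) /= e|st].
  have : free_eq t t by move=> A VA v.
  by rewrite -e.
apply: eq_exist => /=; apply/funext => u; apply/propext.
split=> h A VA v; rewrite /sat_at /=.
  by rewrite -[LHS](st A VA v); exact: (h A VA v).
by rewrite [LHS](st A VA v); exact: (h A VA v).
Qed.

Lemma free_reprK (c : free_carrier) : free_class (free_repr c) = c.
Proof.
rewrite /free_repr; case: cid; case: c => c ct t /= e.
by apply: eq_exist; rewrite e.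
Qed.

Lemma free_reprP (t : term S nat) : free_eq (free_repr (free_class t)) t.
Proof. by apply/free_classP; rewrite free_reprK. Qed.

Lemma free_class_app (f : S) (ts : 'I_(arity f) -> term S nat) :
  free_class (App ts) = op free_alg f (fun k => free_class (ts k)).
Proof.
apply/free_classP => A VA v; rewrite /sat_at /=; congr op.
by apply/funext => k; rewrite [RHS](free_reprP _ VA _).
Qed.

Lemma free_alg_variety : variety V -> V free_alg.
Proof.
case=> E VE; apply/VE => e Ee v.
have eval_free (t : term S nat) :
    exists u : term S nat, eval v t = free_class u /\
      forall (A : algebra S) (w : nat -> A),
        eval w u = eval (fun n => eval w (free_repr (v n))) t.
  elim: t => [n|f ts IH]; first by exists (free_repr (v n)); rewrite free_reprK.
  have [us hus] := choice IH; exists (App us); split=> [|A w].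
    rewrite free_class_app -[LHS]/(op free_alg f (fun k => eval v (ts k))).
    congr (op free_alg f).
    by apply/funext => k; case: (hus k).
  by rewrite /=; congr op; apply/funext => k; case: (hus k).
rewrite /sat_at.
have [s [-> sE]] := eval_free e.1; have [t [-> tE]] := eval_free e.2.
apply/free_classP => A VA w; rewrite /sat_at /= sE tE.
exact: (proj1 (VE A) VA e Ee _).
Qed.

Lemma free_alg_universal (A : algebra S) (v : nat -> A) : V A ->
  exists! h : free_alg -> A, is_hom h /\ forall n, h (free_class (Var S n)) = v n.
Proof.
move=> VA; exists (fun c : free_alg => eval v (free_repr c)); split.
  split=> [f a|n]; last exact: (free_reprP _ VA _).
  exact: (free_reprP _ VA _).
move=> h [hh hv]; apply/funext => c; rewrite -{2}(free_reprK c).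
elim: (free_repr c) => [n|f ts IH]; first by rewrite hv.
rewrite free_class_app hh /=; congr op; exact/funext.
Qed.

End FreeAlgebra.

Section Completeness.
Variables (S : signature) (V : algebra S -> Prop).

Definition structurally_complete : Prop :=
  forall A, V A <-> quasivariety_of (fun B => B = free_alg V) A.

Definition strongly_structurally_complete : Prop :=
  forall A, V A <-> prevariety_of (fun B => B = free_alg V) A.

End Completeness.

(* Main.v *)
Require Import Defs.
From Stdlib Require List.
From mathcomp Require Import all_boot all_order.
From mathcomp Require Import zify.
From mathcomp Require Import boolp classical_sets functions cardinality filter.

Set Implicit Arguments.
Unset Strict Implicit.
Unset Printing Implicit Defensive.

Local Open Scope classical_set_scope.
Local Open Scope card_scope.


(** ** Idea of the proof

    Let [F] be the free algebra of rank omega.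

    From a residual bound to strong structural completeness. If [B] is a finite
    algebra of finite type in the quasivariety of [F], and [a <> b] in [B], then
    some homomorphism from [B] to [F] separates [a] and [b]: otherwise [F], and
    hence [B], would satisfy the quasi-identity whose premises are the
    operation tables of [B] and whose conclusion is [a = b]
    ([finite_separated]). As every member of [V] is a subdirect product of
    subdirectly irreducible members, which are finite, it embeds in a power
    of [F] ([prevariety_of_separated]).

    From strong structural completeness to a residual bound. As [V] is generated
    by finite algebras, [F] is residually finite, and this property is inherited
    by the whole prevariety of [F], that is, by [V]. So all subdirectly
    irreducible members of [V] are finite ([si_finite]). It remains to see that
    a congruence meet-semidistributive variety of finite type with arbitrarily
    large subdirectly irreducible members has an infinite one
    ([infinite_si]).

    This is a compactness argument, and the difficulty is that [(c, d)] may be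
    in the congruence generated by [(a, b)] for reasons of unbounded complexity.
    Complexity is measured by [reach]. An infinite subdirectly irreducible
    algebra is obtained from an ultraproduct as soon as there are pairs
    [c <> d] and arbitrarily large sets, called cliques, any two members of
    which generate [(c, d)] within a number of rounds that depends only on the
    size of the set: a quotient by a maximal congruence separating [c] and [d]
    keeps the members of all cliques apart.

    Meet-semidistributivity enters through [chain_common_link]: when a chain
    connects [u] to [v <> u], one of its links has a nontrivial consequence in
    common with [(u, v)], of complexity bounded in terms of the variety. Now let
    [(s, t)] generate the monolith of a subdirectly irreducible algebra. If every
    pair [(a, b)] has, within bounded distance, a common consequence with
    [(s, t)] and with the pairs below it, then a clique can be made from any
    given elements by treating all pairs of them one after the other. Otherwise
    there is a pair whose shortest connection with [(s, t)] is long, and the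
    pairs met along that connection, taken at sufficiently large gaps, form a
    clique ([clique_of_geodesic]), since otherwise a shortcut would exist. *)

(** * Homomorphisms, quotients and closure of varieties *)

Lemma sig_inj (T : Type) (P : T -> Prop) (x y : {x | P x}) :
  sval x = sval y -> x = y.
Proof. exact: (eq_sig_hprop (fun _ => @Prop_irrelevance _)). Qed.

Section Homomorphisms.
Variable S : signature.
Implicit Types A B C : algebra S.

Lemma hom_eval A B (h : A -> B) X (v : X -> A) (t : term S X) :
  is_hom h -> h (eval v t) = eval (fun x => h (v x)) t.
Proof.
move=> hh; elim: t => [//|f ts IH] /=; rewrite hh.
by congr op; apply/funext => k; exact: IH.
Qed.

Lemma hom_comp A B C (g : B -> C) (h : A -> B) :
  is_hom g -> is_hom h -> is_hom (fun x => g (h x)).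
Proof. by move=> gh hh f a; rewrite hh gh. Qed.

Lemma hom_proj (I : Type) (B : I -> algebra S) (i : I) :
  is_hom (fun x : prod_alg B => x i).
Proof. by []. Qed.

Lemma ker_op A B (h : A -> B) (hh : is_hom h) f (a b : 'I_(arity f) -> A) :
  (forall k, h (a k) = h (b k)) -> h (op A f a) = h (op A f b).
Proof. by move=> ab; rewrite !hh; congr op; apply/funext. Qed.

Definition ker_cong A B (h : A -> B) (hh : is_hom h) : congruence A :=
  @Congruence S A (fun x y => h x = h y) (fun x => erefl) (fun x y => @esym _ _ _)
    (fun x y z => @etrans _ _ _ _) (ker_op hh).

Lemma variety_surj (V : algebra S -> Prop) A B (h : A -> B) :
  variety V -> is_hom h -> (forall y, exists x, h x = y) -> V A -> V B.
Proof.
move=> [E VE] hh hs /VE VA; apply/VE => e Ee v.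
have [w hw] := choice (fun n => hs (v n)).
have -> : v = fun n => h (w n) by apply/funext => n; rewrite hw.
by rewrite /sat_at -!hom_eval //; congr h; exact: VA.
Qed.

Lemma variety_inj (V : algebra S -> Prop) A B (h : A -> B) :
  variety V -> is_hom h -> injective h -> V B -> V A.
Proof.
move=> [E VE] hh hi /VE VB; apply/VE => e Ee v.
by apply: hi; rewrite !hom_eval //; exact: VB.
Qed.

Lemma variety_prod (V : algebra S -> Prop) (I : Type) (B : I -> algebra S) :
  variety V -> (forall i, V (B i)) -> V (prod_alg B).
Proof.
move=> [E VE] VB; apply/VE => e Ee v; apply: functional_extensionality_dep => i.
have ev (t : term S nat) : eval v t i = eval (fun n => v n i) t.
  exact: (hom_eval v t (hom_proj (B := B) i)).
by rewrite !ev; exact: (proj1 (VE _) (VB i)).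
Qed.

Lemma sub_op_hom A (U : subuniverse A) : is_hom (fun x : subalg U => sval x).
Proof. by []. Qed.

Lemma variety_prevariety (V : algebra S -> Prop) : variety V -> prevariety V.
Proof.
move=> vV; split.
- move=> A B [h hh [g hK gK]]; apply: (variety_surj vV hh) => y.
  by exists (g y); rewrite gK.
- move=> A U; apply: (variety_inj vV (@sub_op_hom A U)).
  exact: sig_inj.
- by move=> I B VB; exact: variety_prod.
Qed.

End Homomorphisms.

Section Quotient.
Variables (S : signature) (A : algebra S) (th : congruence A).

Definition quot_carrier : Type := {c : A -> Prop | exists x, c = th x}.

Definition quot_class (x : A) : quot_carrier :=
  exist _ (th x : A -> Prop) (ex_intro _ x erefl).

Definition quot_repr (c : quot_carrier) : A := sval (cid (svalP c)).

Lemma quot_nonempty : inhabited quot_carrier.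
Proof. by case: (carrier_nonempty A) => x; exact: (inhabits (quot_class x)). Qed.

Definition quot_alg : algebra S :=
  {| carrier := quot_carrier;
     op f a := quot_class (op A f (fun k => quot_repr (a k)));
     carrier_nonempty := quot_nonempty |}.

Lemma quot_classP (x y : A) : quot_class x = quot_class y <-> th x y.
Proof.
split=> [/(congr1 sval) /= e|xy]; first by rewrite e; exact: cong_refl.
apply: eq_exist => /=; apply/funext => z; apply/propext; split=> h.
  exact: cong_trans (cong_sym xy) h.
exact: cong_trans xy h.
Qed.

Lemma quot_reprK (c : quot_carrier) : quot_class (quot_repr c) = c.
Proof.
rewrite /quot_repr; case: cid; case: c => c ct x /= e.
by apply: eq_exist; rewrite e.
Qed.

Lemma quot_hom : is_hom (quot_class : A -> quot_alg).
Proof.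
move=> f a; apply/quot_classP; apply: cong_op => k.
by apply/quot_classP; rewrite quot_reprK.
Qed.

Lemma variety_quot (V : algebra S -> Prop) : variety V -> V A -> V quot_alg.
Proof.
move=> vV; apply: (variety_surj vV quot_hom) => c.
by exists (quot_repr c); exact: quot_reprK.
Qed.

End Quotient.

(** * Subdirectly irreducible quotients *)

Section SubdirectlyIrreducible.
Variable S : signature.
Implicit Types A B : algebra S.

Lemma maximal_avoiding A (a b : A) : a <> b ->
  exists th : congruence A, ~ th a b /\
    forall ph : congruence A, (forall x y, th x y -> ph x y) -> ~ ph a b ->
      forall x y, ph x y -> th x y.
Proof.
move=> nab; pose T := {th : congruence A | ~ th a b}.
pose R (s t : T) := `[< cong_sub (sval s) (sval t) >].
have refl_hom : is_hom (@id A) by [].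
have idT : ~ ker_cong refl_hom a b by [].
have [| | | |th thmax] := @Zorn T R.
- by move=> t; apply/asboolP.
- move=> r s t /asboolP rs /asboolP st; apply/asboolP => x y rxy.
  exact/st/rs.
- move=> s t /asboolP st /asboolP ts; apply: sig_inj.
  by apply: cong_ext => x y; split; [exact: st|exact: ts].
- move=> D Dtot.
  case: (pselect (exists d, D d)) => [[d0 Dd0]|nD]; last first.
    exists (exist _ (ker_cong refl_hom) idT) => s Ds.
    by case: nD; exists s.
  pose rel x y := exists2 d, D d & sval d x y.
  have common d e : D d -> D e -> exists2 g, D g &
      cong_sub (sval d) (sval g) /\ cong_sub (sval e) (sval g).
    move=> Dd De; have [/asboolP h|/asboolP h] := Dtot _ _ Dd De.
      by exists e => //; split=> x y; first exact: h.
    by exists d => //; split=> x y; last exact: h.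
  have rrefl x : rel x x by exists d0 => //; exact: cong_refl.
  have rsym x y : rel x y -> rel y x.
    by move=> [d Dd h]; exists d => //; exact: cong_sym.
  have rtrans x y z : rel x y -> rel y z -> rel x z.
    move=> [d Dd xy] [e De yz]; have [g Dg [dg eg]] := common _ _ Dd De.
    by exists g => //; apply: (cong_trans (y := y)); [exact: dg|exact: eg].
  have bound n (x y : 'I_n -> A) : (forall k, rel (x k) (y k)) ->
      exists2 d, D d & forall k, sval d (x k) (y k).
    elim: n x y => [|n IH] x y xy; first by exists d0 => // -[].
    have [d Dd hd] := IH _ _ (fun k => xy (lift ord0 k)).
    have [e De he] := xy ord0; have [g Dg [dg eg]] := common _ _ Dd De.
    exists g => // k; case: (unliftP ord0 k) => [j|] ->.
      exact/dg/hd.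
    exact/eg/he.
  have rop f x y : (forall k, rel (x k) (y k)) -> rel (op A f x) (op A f y).
    by move=> /bound[d Dd h]; exists d => //; exact: cong_op.
  pose th := Congruence rrefl rsym rtrans rop.
  have nth : ~ th a b by move=> [d _]; exact: svalP d.
  by exists (exist _ th nth) => s Ds; apply/asboolP => x y sxy; exists s.
exists (sval th); split; first exact: svalP th.
move=> ph thph nph x y; have := thmax (exist _ ph nph).
by rewrite /R /= => /(_ (asboolT thph)) <-.
Qed.

Lemma si_maximal_avoiding A (a b : A) (th : congruence A) : ~ th a b ->
  (forall ph : congruence A, (forall x y, th x y -> ph x y) -> ~ ph a b ->
     forall x y, ph x y -> th x y) ->
  subdirectly_irreducible (quot_alg th).
Proof.
move=> nab thmax I B h [hh hi hs].
have /existsNP[i hi_ab] :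
    ~ forall i, h (quot_class th a) i = h (quot_class th b) i.
  move=> e; apply/nab/quot_classP/hi.
  exact: functional_extensionality_dep.
have ph_hom : is_hom (fun x => h (quot_class th x) i).
  exact: hom_comp (hom_proj (B := B) i) (hom_comp hh (@quot_hom _ _ th)).
have ph_th x y : ker_cong ph_hom x y -> th x y.
  apply: (thmax (ker_cong ph_hom)) => // {}x {}y /quot_classP e /=.
  by rewrite /ker_cong /= e.
exists i; have inj : injective (fun x => h x i).
  move=> c d; rewrite -(quot_reprK c) -(quot_reprK d) => e.
  exact/quot_classP/ph_th.
have [g hg] := choice (hs i); exists g => x; last exact: hg.
by apply: inj; rewrite hg.
Qed.

Lemma si_quotient_separating A (a b : A) : a <> b -> exists th : congruence A,
  ~ th a b /\ subdirectly_irreducible (quot_alg th).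
Proof.
move=> /maximal_avoiding[th [nab thmax]].
by exists th; split=> //; exact: si_maximal_avoiding thmax.
Qed.

(** Subdirect irreducibility, phrased through subdirect embeddings, is used
    in this form: the zero congruence is not a meet of nonzero ones. *)
Lemma si_trivial_congruence A (I : Type) (th : I -> congruence A) :
  subdirectly_irreducible A ->
  (forall x y, (forall i, th i x y) -> x = y) ->
  exists i, forall x y, th i x y -> x = y.
Proof.
move=> siA sep.
pose h (x : A) : prod_alg (fun i => quot_alg (th i)) := fun i => quot_class (th i) x.
have [i [g hK gK]] : exists i, bijective (fun x => h x i).
  apply: siA; split.
  - move=> f a; apply: functional_extensionality_dep => i; exact: quot_hom.
  - move=> x y e; apply: sep => i; apply/quot_classP.
    by rewrite -[LHS]/(h x i) e.
  - by move=> i c; exists (quot_repr c); exact: quot_reprK.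
by exists i => x y /quot_classP e; rewrite -(hK x) /h e; exact: hK.
Qed.

End SubdirectlyIrreducible.

(** * Bounded principal congruences *)

Section Reach.
Variable S : signature.

(** The principal congruence of [(a, b)], stratified by the number of rounds
    in which it is generated. The strata, unlike their union, pass through
    ultraproducts, which is why all estimates are made in terms of them. *)
Fixpoint reach (A : algebra S) (a b : A) (k : nat) (x y : A) : Prop :=
  if k is k'.+1 then
    (exists z, reach a b k' x z /\ reach a b k' z y) \/
    (exists (f : S) (xs ys : 'I_(arity f) -> A),
       [/\ x = op A f xs, y = op A f ys & forall i, reach a b k' (xs i) (ys i)])
  else x = y \/ (x = a /\ y = b) \/ (x = b /\ y = a).

Section ReachTheory.
Variable A : algebra S.
Implicit Types a b c d x y z : A.

Lemma reach_refl a b k x : reach a b k x x.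
Proof. by elim: k => [|k IH] /=; left => //; exists x. Qed.

Lemma reach_gen a b : reach a b 0 a b.
Proof. by right; left. Qed.

Lemma reach_trans a b k x y z :
  reach a b k x y -> reach a b k y z -> reach a b k.+1 x z.
Proof. by move=> xy yz; left; exists y. Qed.

Lemma reach_leq a b k l x y : k <= l -> reach a b k x y -> reach a b l x y.
Proof.
move=> /subnKC <-; elim: (l - k) => [|n IH] h; first by rewrite addn0.
by rewrite addnS; apply: reach_trans (IH h) _; exact: reach_refl.
Qed.

Lemma reach_sym a b k x y : reach a b k x y -> reach a b k y x.
Proof.
elim: k x y => [|k IH] x y /=.
  by case=> [->|[[-> ->]|[-> ->]]]; [left|right; right|right; left].
case=> [[z [/IH xz /IH zy]]|[f [xs [ys [-> -> h]]]]]; [left; exists z|right] => //.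
by exists f, ys, xs; split=> // i; exact: IH.
Qed.

Lemma reach_swap a b k x y : reach a b k x y -> reach b a k x y.
Proof.
elim: k x y => [|k IH] x y /=.
  by case=> [->|[[-> ->]|[-> ->]]]; [left|right; right|right; left].
case=> [[z [/IH xz /IH zy]]|[f [xs [ys [-> -> h]]]]]; [left; exists z|right] => //.
by exists f, xs, ys; split=> // i; exact: IH.
Qed.

Lemma reach_comp a b k c d l x y :
  reach a b k c d -> reach c d l x y -> reach a b (k + l) x y.
Proof.
move=> cd; elim: l x y => [|l IH] x y /=; rewrite ?addn0 ?addnS.
  by case=> [->|[[-> ->]|[-> ->]]] //; [exact: reach_refl|exact: reach_sym].
case=> [[z [/IH xz /IH zy]]|[f [xs [ys [-> -> h]]]]]; [left; exists z|right] => //.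
by exists f, xs, ys; split=> // i; exact: IH.
Qed.

Lemma reach_cong (th : congruence A) a b k x y :
  th a b -> reach a b k x y -> th x y.
Proof.
move=> ab; elim: k x y => [|k IH] x y /=.
  case=> [->|[[-> ->]|[-> ->]]] //; [exact: cong_refl|exact: cong_sym].
case=> [[z [/IH xz /IH zy]]|[f [xs [ys [-> -> h]]]]]; first exact: cong_trans zy.
by apply: cong_op => i; exact: IH.
Qed.

Lemma reach_op_bound a b n (x y : 'I_n -> A) :
  (forall i, exists k, reach a b k (x i) (y i)) ->
  exists k, forall i, reach a b k (x i) (y i).
Proof.
move=> /choice[k hk]; exists (\max_i k i) => i.
exact: reach_leq (leq_bigmax i) (hk i).
Qed.

Lemma cg_op a b f (x y : 'I_(arity f) -> A) :
  (forall i, exists k, reach a b k (x i) (y i)) ->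
  exists k, reach a b k (op A f x) (op A f y).
Proof. by move=> /reach_op_bound[k h]; exists k.+1; right; exists f, x, y. Qed.

Lemma cg_trans a b x y z : (exists k, reach a b k x y) ->
  (exists k, reach a b k y z) -> exists k, reach a b k x z.
Proof.
move=> [k xy] [l yz]; exists (maxn k l).+1; apply: (reach_trans (y := y)).
  exact: reach_leq (leq_maxl k l) xy.
exact: reach_leq (leq_maxr k l) yz.
Qed.

Definition cg a b : congruence A :=
  @Congruence S A (fun x y => exists k, reach a b k x y)
    (fun x => ex_intro _ 0 (reach_refl a b 0 x))
    (fun x y '(ex_intro k h) => ex_intro _ k (reach_sym h))
    (@cg_trans a b) (@cg_op a b).

Fixpoint depth X (t : term S X) : nat :=
  match t with
  | Var _ => 0
  | App f ts => (\max_(i < arity f) depth (ts i)).+1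
  end.

Lemma reach_eval X a b k (v w : X -> A) (t : term S X) :
  (forall n, reach a b k (v n) (w n)) ->
  reach a b (k + depth t) (eval v t) (eval w t).
Proof.
move=> vw; elim: t => [x|f ts IH] /=; first by rewrite addn0.
rewrite addnS; right; exists f, (fun i => eval v (ts i)), (fun i => eval w (ts i)).
split=> // i; apply: reach_leq (IH i); rewrite leq_add2l.
exact: (leq_bigmax (F := fun i => depth (ts i))).
Qed.

Inductive chain (Q : A -> A -> Prop) (x : A) : A -> Prop :=
| chain_refl : chain Q x x
| chain_step y z : chain Q x y -> Q y z -> chain Q x z.

Lemma chain1 (Q : A -> A -> Prop) x y : Q x y -> chain Q x y.
Proof. by move=> xy; exact: chain_step (chain_refl Q x) xy. Qed.

Lemma chain_trans (Q : A -> A -> Prop) x y z :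
  chain Q x y -> chain Q y z -> chain Q x z.
Proof. by move=> xy yz; elim: yz => // u w _ IH uw; exact: chain_step IH uw. Qed.

Lemma chain_map (Q R : A -> A -> Prop) (h : A -> A) x y :
  (forall u w, Q u w -> chain R (h u) (h w)) ->
  chain Q x y -> chain R (h x) (h y).
Proof.
move=> QR; elim=> [|u w _ IH uw]; first exact: chain_refl.
exact: chain_trans IH (QR _ _ uw).
Qed.

Lemma chain_change (Q : A -> A -> Prop) (E : A -> Prop) x y :
  chain Q x y -> ~ (E x <-> E y) -> exists u w, Q u w /\ ~ (E u <-> E w).
Proof.
elim=> [|u w _ IH uw] nE; first by case: nE.
have [xu|/IH //] := pselect (E x <-> E u).
by exists u, w; split=> //; rewrite -xu.
Qed.

(** The basic translations of Maltsev; words of them are kept as lists, so that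
    they can be cut at a given length. *)
Definition translation : Type := {f : S & ('I_(arity f) * ('I_(arity f) -> A))%type}.

Definition translate (tr : translation) (x : A) : A :=
  op A (tag tr) (fun i => if i == (tagged tr).1 then x else (tagged tr).2 i).

Definition act (w : seq translation) (x : A) : A := foldr translate x w.

Lemma act_cat w1 w2 x : act (w1 ++ w2) x = act w1 (act w2 x).
Proof. by rewrite /act foldr_cat. Qed.

Lemma reach_act w x y : reach x y (size w) (act w x) (act w y).
Proof.
elim: w => [|tr w IH] /=; first exact: reach_gen.
pose args z i := if i == (tagged tr).1 then act w z else (tagged tr).2 i.
right; exists (tag tr), (args x), (args y).
by split=> // i; rewrite /args; case: ifP => _; [exact: IH|exact: reach_refl].
Qed.

Lemma reach_of_act w a b k x y :
  reach (act w a) (act w b) k x y -> reach a b (size w + k) x y.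
Proof. exact: reach_comp (reach_act w a b). Qed.

Definition link a b k x y : Prop := exists2 w, size w <= k &
  (x = act w a /\ y = act w b) \/ (x = act w b /\ y = act w a).

Lemma link_leq a b k l x y : k <= l -> link a b k x y -> link a b l x y.
Proof. by move=> kl [w wk h]; exists w => //; exact: leq_trans kl. Qed.

(** Maltsev's description of principal congruences: arguments of an operation
    are changed one at a time. *)
Lemma chain_op (Q R : A -> A -> Prop) (f : S) (xs ys : 'I_(arity f) -> A) :
  (forall tr x y, Q x y -> R (translate tr x) (translate tr y)) ->
  (forall i, chain Q (xs i) (ys i)) -> chain R (op A f xs) (op A f ys).
Proof.
move=> QR xy; pose zs n (i : 'I_(arity f)) := if (i < n)%N then ys i else xs i.
have step n : n <= arity f -> chain R (op A f xs) (op A f (zs n)).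
  elim: n => [|n IH] nf.
    suff -> : zs 0 = xs by exact: chain_refl.
    by apply/funext => i.
  apply: chain_trans (IH (ltnW nf)) _.
  pose tr : translation :=
    Tagged (fun f : S => ('I_(arity f) * ('I_(arity f) -> A))%type) (Ordinal nf, zs n).
  have -> : op A f (zs n) = translate tr (xs (Ordinal nf)).
    rewrite /translate /=; congr op; apply/funext => i.
    have [->|//] := eqVneq i (Ordinal nf).
    by rewrite /zs /= ltnn.
  have -> : op A f (zs n.+1) = translate tr (ys (Ordinal nf)).
    rewrite /translate /=; congr op; apply/funext => i.
    have [->|ni] := eqVneq i (Ordinal nf).
      by rewrite /zs /= ltnSn.
    rewrite /zs ltnS leq_eqVlt; case: eqP => //= e.
    by case/eqP: ni; exact: val_inj.
  apply: chain_map (xy _) => u w uw; apply: chain1; exact: QR.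
have -> : ys = zs (arity f) by apply/funext => i; rewrite /zs ltn_ord.
exact: step.
Qed.

Lemma reach_chain a b k x y : reach a b k x y -> chain (link a b k) x y.
Proof.
elim: k x y => [|k IH] x y /=.
  case=> [->|h]; first exact: chain_refl.
  by apply: chain1; exists [::].
case=> [[z [/IH xz /IH zy]]|[f [xs [ys [-> -> h]]]]].
  have mono u w : link a b k u w -> chain (link a b k.+1) u w.
    by move=> uw; apply/chain1/(link_leq (leqnSn k)).
  apply: chain_trans; [exact: (chain_map (h := id) mono) xz|].
  exact: (chain_map (h := id) mono) zy.
apply: (chain_op (Q := link a b k)) => [tr {}x {}y [w wk]|i]; last exact/IH/h.
by move=> [[-> ->]|[-> ->]]; exists (tr :: w) => //; [left|right].
Qed.

End ReachTheory.

End Reach.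

(** * Reduced products and ultraproducts *)

Lemma finite_enum (T : Type) (D : set T) : finite_set D ->
  exists s : seq T, forall x, D x <-> List.In x s.
Proof.
move=> /(@finite_seqP {classic T})[s ->]; exists s => x /=.
elim: s => [//|y s IH] /=; split=> [/(@predU1P {classic T})[->|/IH]|[->|/IH xs]].
- by left.
- by right.
- by apply/(@predU1P {classic T}); left.
- by apply/(@predU1P {classic T}); right.
Qed.

Lemma choice_dep (I : Type) (T : I -> Type) (P : forall i, T i -> Prop) :
  (forall i, exists x, P i x) -> exists f, forall i, P i (f i).
Proof. by move=> h; exists (fun i => sval (cid (h i))) => i; exact: svalP. Qed.

Lemma ultra_finite_union (T I : Type) (U : set_system T) (P : I -> set T) :
  UltraFilter U -> finite_set [set: I] -> U (\bigcup_i P i) -> exists i, U (P i).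
Proof.
move=> UU /finite_enum[s hs] UP; apply: contrapT => /forallNP nU.
have UF : Filter U by exact: filter_filter.
have all_out r : U [set x | forall i, List.In i r -> ~ P i x].
  elim: r => [|i r IH]; first by apply: (filterS _ filterT) => x _ i [].
  have Ui : U (~` P i) by case: (in_ultra_setVsetC (P i) UU) => [/nU|].
  by apply: (filterS _ (filterI Ui IH)) => x [ix rx] j /= [<-|/rx].
suff e : \bigcup_i P i `&` [set x | forall i, List.In i s -> ~ P i x] = set0.
  apply: (@filter_not_empty _ U ultra_proper); rewrite -e.
  exact: filterI UP (all_out s).
by apply/seteqP; split=> // x [[i _ Pi] /(_ i (proj1 (hs i) Logic.I))].
Qed.

Section ReducedProduct.
Variables (S : signature) (U : set_system nat).
Context {FU : Filter U}.
Variable B : nat -> algebra S.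

Lemma reduced_sym (x y : prod_alg B) :
  U [set n | x n = y n] -> U [set n | y n = x n].
Proof. by apply: filterS => n /= ->. Qed.

Lemma reduced_trans (x y z : prod_alg B) : U [set n | x n = y n] ->
  U [set n | y n = z n] -> U [set n | x n = z n].
Proof. by move=> xy yz; apply: (filterS _ (filterI xy yz)) => n [/= -> ->]. Qed.

Lemma reduced_op (f : S) (x y : 'I_(arity f) -> prod_alg B) :
  (forall k, U [set n | x k n = y k n]) ->
  U [set n | op (prod_alg B) f x n = op (prod_alg B) f y n].
Proof.
move=> /filter_forall; apply: filterS => n /= xy.
by congr op; apply/funext => k; exact: xy.
Qed.

Lemma reduced_refl (x : prod_alg B) : U [set n | x n = x n].
Proof. by apply: (filterS _ filterT) => n. Qed.

Definition reduced_cong : congruence (prod_alg B) :=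
  @Congruence S (prod_alg B) (fun x y => U [set n | x n = y n])
    reduced_refl reduced_sym reduced_trans reduced_op.

Definition reduced_prod : algebra S := quot_alg reduced_cong.

Definition limit (x : forall n, B n) : reduced_prod := quot_class reduced_cong x.

Lemma limitP (x y : forall n, B n) :
  limit x = limit y <-> U [set n | x n = y n].
Proof. exact: (quot_classP reduced_cong). Qed.

Lemma limit_op f (x : 'I_(arity f) -> forall n, B n) :
  limit (fun n => op (B n) f (fun i => x i n)) =
  op reduced_prod f (fun i => limit (x i)).
Proof. exact: (quot_hom reduced_cong). Qed.

Lemma limit_eval X (v : X -> forall n, B n) (t : term S X) :
  eval (fun x => limit (v x)) t = limit (fun n => eval (fun x => v x n) t).
Proof.
elim: t => [//|f ts IH]; rewrite [RHS](limit_op (fun i n => eval (v^~ n) (ts i))).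
by apply: (congr1 (op reduced_prod f)); apply/funext => i; exact: IH.
Qed.

Lemma variety_reduced (V : algebra S -> Prop) :
  variety V -> (forall n, V (B n)) -> V reduced_prod.
Proof. by move=> vV VB; apply: variety_quot => //; exact: variety_prod. Qed.

End ReducedProduct.

Section Ultraproduct.
Variables (S : signature) (U : set_system nat) (UU : UltraFilter U).
Context {FU : Filter U}.
Variable B : nat -> algebra S.

Notation lim := (@limit S U FU B).

(** Only finitely many operation symbols can occur in the last round, so one
    and the same symbol occurs in almost all factors. *)
Lemma reach_limit (a b x y : forall n, B n) k : finite_type S ->
  U [set n | reach (a n) (b n) k (x n) (y n)] ->
  reach (lim a) (lim b) k (lim x) (lim y).
Proof.
move=> fin; elim: k x y => [|k IH] x y.
  have either (P Q : set nat) : U (P `|` Q) -> U P \/ U Q.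
    move=> PQ; case: (in_ultra_setVsetC P UU) => [|nP]; [by left|right].
    by apply: (filterS _ (filterI PQ nP)) => n [[]].
  have both (P Q : set nat) : U (P `&` Q) -> U P /\ U Q.
    by move=> PQ; split; apply: (filterS _ PQ) => n [].
  move=> /either[/limitP|/either[/both[]|/both[]]]; first by left.
    by move=> /limitP xa /limitP yb; right; left.
  by move=> /limitP xb /limitP ya; right; right.
move=> /= h; have [hz|hz] := in_ultra_setVsetC
    [set n | exists z, reach (a n) (b n) k (x n) z /\ reach (a n) (b n) k z (y n)] UU.
  have [n|z zP] := @choice_dep nat B (fun n z =>
      (exists z, reach (a n) (b n) k (x n) z /\ reach (a n) (b n) k z (y n)) ->
      reach (a n) (b n) k (x n) z /\ reach (a n) (b n) k z (y n)).
    case: (pselect (exists z, reach (a n) (b n) k (x n) z /\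
                              reach (a n) (b n) k z (y n))) => [[z]|nz].
      by exists z.
    by exists (x n) => /nz.
  by left; exists (lim z); split; apply: IH; apply: (filterS _ hz) => n /zP[].
pose P f n := exists xs ys : 'I_(arity f) -> B n,
  [/\ x n = op (B n) f xs, y n = op (B n) f ys &
      forall i, reach (a n) (b n) k (xs i) (ys i)].
have [|f Uf] := @ultra_finite_union nat S U P UU fin.
  apply: (filterS _ (filterI h hz)) => n [[//|[f [xs [ys fxy]]]] _].
  by exists f => //; exists xs, ys.
have [n|xy xyP] := @choice_dep nat (fun n => 'I_(arity f) -> B n * B n)%type
    (fun n xy => P f n -> [/\ x n = op (B n) f (fun i => (xy i).1),
      y n = op (B n) f (fun i => (xy i).2) &
      forall i, reach (a n) (b n) k (xy i).1 (xy i).2]).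
  case: (pselect (P f n)) => [[xs [ys h']]|nP]; last by exists (fun=> (x n, x n)).
  by exists (fun i => (xs i, ys i)).
right; exists f, (fun i => lim (fun n => (xy n i).1)),
  (fun i => lim (fun n => (xy n i).2)).
split.
- apply: etrans (limit_op (fun i n => (xy n i).1)); apply/limitP.
  by apply: (filterS _ Uf) => n /xyP[].
- apply: etrans (limit_op (fun i n => (xy n i).2)); apply/limitP.
  by apply: (filterS _ Uf) => n /xyP[].
by move=> i; apply: IH; apply: (filterS _ Uf) => n /xyP[_ _ /(_ i)].
Qed.

End Ultraproduct.

(** * Terms witnessing meet-semidistributivity *)

Section FreeExtension.
Variables (S : signature) (V : algebra S -> Prop) (A : algebra S).
Hypothesis VA : V A.

Definition free_ext (v : nat -> A) (c : free_alg V) : A := eval v (free_repr c).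

Lemma free_ext_class v t : free_ext v (free_class V t) = eval v t.
Proof. exact: (free_reprP _ VA v). Qed.

Lemma free_ext_hom v : is_hom (free_ext v).
Proof. by move=> f a; rewrite free_ext_class. Qed.

End FreeExtension.

Section Willard.
Variables (S : signature) (V : algebra S -> Prop).
Hypothesis vV : variety V.
Hypothesis sdV : congruence_meet_semidistributive V.

Definition val3 (T : Type) (x y z : T) (n : nat) : T :=
  match n with 0 => x | 1 => y | _ => z end.

Definition ev3 (A : algebra S) (x y z : A) (t : term S nat) : A :=
  eval (val3 x y z) t.

Definition willard_pair (f g : term S nat) : Prop :=
  forall (A : algebra S), V A -> forall x y : A, ev3 x y x f = ev3 x y x g.

(** In the free algebra on [x, y, z], let [al] be the congruence of the pairs
    [(f, g)] with [f(x,y,x) = g(x,y,x)], and let [k1], [k2] be the kernels of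
    [x, y, z |-> a, a, b] and [x, y, z |-> a, b, b]. The hypothesis says that
    [al] has the same meet with [k1] and [k2], hence with their join; but
    [(x, z)] is in [al], and in the join by way of [y]. *)
Lemma willard_family (A : algebra S) (a b : A) : V A ->
  (forall f g, willard_pair f g ->
     (ev3 a a b f = ev3 a a b g <-> ev3 a b b f = ev3 a b b g)) ->
  a = b.
Proof.
move=> VA wab.
have VF := free_alg_variety vV; pose X n : free_alg V := free_class V (Var S n).
pose al := ker_cong (free_ext_hom VF (val3 (X 0) (X 1) (X 0))).
pose k1 := ker_cong (free_ext_hom VA (val3 a a b)).
pose k2 := ker_cong (free_ext_hom VA (val3 a b b)).
have alw c d : al c d -> willard_pair (free_repr c) (free_repr d).
  move=> cd B VB x y.
  have := congr1 (free_ext (val3 x y x)) cd.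
  rewrite /= /free_ext -!/(free_ext _ _).
  rewrite !(hom_eval _ _ (free_ext_hom VB _)) /ev3.
  have -> // : (fun n => free_ext (val3 x y x) (val3 (X 0) (X 1) (X 0) n)) =
      val3 x y x.
  by apply/funext => -[|[|n]]; rewrite /= free_ext_class.
have e12 : (Order.meet al k1 = Order.meet al k2)%O.
  by apply: cong_ext => c d; split=> -[acd kcd]; split=> //;
    apply/(wab _ _ (alw _ _ acd)).
have : Order.meet al (Order.join k1 k2) (X 0) (X 2).
  split; first by rewrite /= !free_ext_class.
  move=> t k1t k2t; apply: (cong_trans (y := X 1)).
    by apply: k1t; rewrite /= !free_ext_class.
  by apply: k2t; rewrite /= !free_ext_class.
rewrite -(sdV VF e12) => -[_].
by rewrite /= !free_ext_class.
Qed.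

(** By compactness, pairs of terms of bounded depth suffice. If for every [n]
    some algebra had a counterexample for terms of depth at most [n], then the
    product reduced modulo the cofinite filter would have a counterexample for
    all terms. *)
Lemma willard_terms : exists K, forall (A : algebra S) (a b : A), V A -> a <> b ->
  exists f g, [/\ willard_pair f g, depth f <= K, depth g <= K &
    ~ (ev3 a a b f = ev3 a a b g <-> ev3 a b b f = ev3 a b b g)].
Proof.
apply: contrapT => /forallNP noK.
have [n|B Bcex] := @choice_dep nat (fun _ => algebra S) (fun n A =>
    V A /\ exists a b : A, a <> b /\ forall f g, willard_pair f g ->
      depth f <= n -> depth g <= n ->
      (ev3 a a b f = ev3 a a b g <-> ev3 a b b f = ev3 a b b g)).
  have /existsNP[A /existsNP[a /existsNP[b /not_implyP[VA /not_implyP[ab h]]]]] :=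
    noK n.
  exists A; split=> //; exists a, b; split=> // f g wfg fn gn.
  by apply: contrapT => nfg; apply: h; exists f, g.
have [a aP] := choice_dep (fun n => proj2 (Bcex n)).
have [b bP] := choice_dep aP.
have FF : Filter eventually by exact: (@filter_filter _ _ eventually_filter).
pose lim (x : forall n, B n) := @limit S eventually FF B x.
have ev n0 (P : nat -> Prop) : (forall n, n0 <= n -> P n) -> eventually [set n | P n].
  by move=> h; exists n0.
suff /limitP [n _ /(_ n (leqnn n)) /=] : lim a = lim b by case: (bP n).
apply: willard_family => [|f g wfg].
  by apply: variety_reduced => // n; case: (Bcex n).
have elim3 x y z t : ev3 (lim x) (lim y) (lim z) t =
    lim (fun n => ev3 (x n) (y n) (z n) t).
  have -> : ev3 (lim x) (lim y) (lim z) t =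
      eval (fun m => limit (U := eventually) (val3 x y z m)) t.
    by congr eval; apply/funext => -[|[|m]].
  rewrite limit_eval; apply: (congr1 lim); apply: functional_extensionality_dep => n.
  by congr eval; apply/funext => -[|[|m]].
have large := ev (maxn (depth f) (depth g)) _ (fun n h =>
  (proj2 (bP n)) f g wfg (leq_trans (leq_maxl _ _) h) (leq_trans (leq_maxr _ _) h)).
rewrite !elim3; split=> /limitP h; apply/limitP.
  by apply: (filterS _ (filterI large h)) => n [/= [fg _] /fg].
by apply: (filterS _ (filterI large h)) => n [/= [_ gf] /gf].
Qed.

End Willard.

(** * Common consequences of two pairs *)

Definition common (S : signature) (A : algebra S) k (a b s t : A) : Prop :=
  exists c d, [/\ c <> d, reach a b k c d & reach s t k c d].

Lemma common_sym (S : signature) (A : algebra S) k (a b s t : A) :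
  common k a b s t -> common k s t a b.
Proof. by move=> [c [d [cd ab st]]]; exists c, d. Qed.

Lemma common_swap (S : signature) (A : algebra S) k (a b s t : A) :
  common k a b s t -> common k b a s t.
Proof. by move=> [c [d [cd ab st]]]; exists c, d; split=> //; exact: reach_swap. Qed.

(** Whatever its length, a chain from [u] to [v] has a link sharing a nontrivial
    pair with [(u, v)] within a number of rounds that depends on the variety
    only. For suitable terms [f], [g], the equality of [f(u, z, v)] and
    [g(u, z, v)] holds for [z] at one end of the chain only, so it is lost
    across some link [(x, y)], say true at [x]. Then [f(u, y, v)] and
    [g(u, y, v)] are connected by [f(u, x, v) = g(u, x, v)] within the
    congruence of [(x, y)], and by [f(u, y, u) = g(u, y, u)] within that of
    [(u, v)]. *)
Lemma chain_common_link (S : signature) (V : algebra S -> Prop) :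
  variety V -> congruence_meet_semidistributive V ->
  exists k, forall A, V A -> forall (Q : A -> A -> Prop) u v, u <> v ->
    chain Q u v -> exists x y, Q x y /\ common k x y u v.
Proof.
move=> vV sdV; have [K hK] := willard_terms vV sdV; exists K.+1.
move=> A VA Q u v uv Quv; have [f [g [wfg fK gK nfg]]] := hK A u v VA uv.
pose E z := ev3 u z v f = ev3 u z v g.
have [x [y [Qxy nE]]] := chain_change (E := E) Quv nfg.
exists x, y; split=> //.
have mid x' y' r : depth r <= K -> reach x' y' K (ev3 u x' v r) (ev3 u y' v r).
  move=> rK; apply: (reach_leq rK).
  apply: (reach_eval (k := 0)) => -[|[|n]] /=; by [left|right; left].
have right_end y' r : depth r <= K -> reach u v K (ev3 u y' u r) (ev3 u y' v r).
  move=> rK; apply: (reach_leq rK).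
  apply: (reach_eval (k := 0)) => -[|[|n]] /=; by [left|right; left].
have half x' y' : E x' -> ~ E y' -> common K.+1 x' y' u v.
  move=> Ex nEy; exists (ev3 u y' v f), (ev3 u y' v g); split=> //.
    apply: (reach_trans (y := ev3 u x' v f)); first exact/reach_sym/mid.
    by rewrite Ex; exact: mid.
  apply: (reach_trans (y := ev3 u y' u f)); first exact/reach_sym/right_end.
  by rewrite (wfg A VA); exact: right_end.
have [Ex|nEx] := pselect (E x).
  by apply: half => // Ey; apply: nE.
by apply/common_swap/half => //; apply: contrapT => nEy; apply: nE.
Qed.

Section Cliques.
Variables (S : signature) (V : algebra S -> Prop) (k0 : nat).
Hypothesis common_link : forall A : algebra S, V A ->
  forall (Q : A -> A -> Prop) u v, u <> v ->
  chain Q u v -> exists x y, Q x y /\ common k0 x y u v.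

Section InAlgebra.
Variable A : algebra S.
Hypothesis VA : V A.
Implicit Types a b c d s t u v x y : A.

Lemma reach_common_act k a b u v : u <> v -> reach a b k u v ->
  exists2 w, size w <= k & common k0 (act w a) (act w b) u v.
Proof.
move=> uv /reach_chain /(common_link VA uv)[x [y [[w wk xy] cxy]]].
exists w => //; case: xy cxy => -[-> ->] // ; exact: common_swap.
Qed.

(** The fixed number [k0 + k0] of rounds is enough, whatever the complexity of
    the common consequence: by [joined_of_reach], further rounds can be absorbed
    into the words. *)
Definition joined n a b s t : Prop := exists w w',
  size w + size w' <= n /\
  common (k0 + k0) (act w a) (act w b) (act w' s) (act w' t).

Lemma joined_sym n a b s t : joined n a b s t -> joined n s t a b.
Proof.
move=> [w [w' [wn c]]]; exists w', w; rewrite addnC.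
by split=> //; exact: common_sym.
Qed.

Lemma joined_of_reach m a b s t u v n w : u <> v ->
  reach (act w a) (act w b) k0 u v -> reach s t n u v -> size w + n <= m ->
  joined m a b s t.
Proof.
move=> uv ab st wm; have [w' w'n [c' [d' [cd' st' uv']]]] := reach_common_act uv st.
exists w, w'; split; first exact: leq_trans (leq_add (leqnn _) w'n) wm.
exists c', d'; split=> //; first exact: reach_comp ab uv'.
exact: reach_leq (leq_addr _ _) st'.
Qed.

(** The members of a clique are taken in [A * A], because for any two of them
    it is out of control whether the first or the second coordinates generate
    [(c, d)]. In either case a quotient separating [c] and [d] separates them,
    so that a large clique makes the quotient large. *)
Definition clique k h c d : Prop := exists p q : nat -> A,
  forall i j, i < j < k -> reach (p i) (p j) h c d \/ reach (q i) (q j) h c d.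

Lemma clique_reach k h l c d x y :
  clique k h c d -> reach c d l x y -> clique k (h + l) x y.
Proof.
move=> [p [q pq]] xy; exists p, q => i j /pq[h'|h']; [left|right];
  exact: reach_comp h' xy.
Qed.

Lemma clique_leq k h l c d : h <= l -> clique k h c d -> clique k l c d.
Proof.
by move=> hl [p [q pq]]; exists p, q => i j /pq[h'|h']; [left|right];
  exact: reach_leq h'.
Qed.

(** A common consequence takes [k0 + k0] rounds at the outset, and [k0] more
    each time it is lowered. *)
Definition rounds n := (n.+2 * k0)%N.

Lemma roundsS n : rounds n.+1 = rounds n + k0.
Proof. by rewrite /rounds mulSn addnC. Qed.

Lemma index_pairs k : exists L : seq (nat * nat),
  size L <= k * k /\ forall i j, i < j < k -> (i, j) \in L.
Proof.
exists [seq (i, j) | i <- iota 0 k, j <- iota 0 k].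
rewrite size_allpairs !size_iota; split=> // i j /andP[ij jk].
by apply: allpairs_f; rewrite mem_iota //= (ltn_trans ij jk).
Qed.

(** Let [w] and [w'] realize the least total length joining [(a, b)] and
    [(s, t)], and let [w] be long. Removing the first [i * g] letters of [w]
    gives a pair [(p i, q i)] on the way from [(a, b)] to the pair [(u, v)] at
    the end of [w], and the removed letters form a translation [T] with
    [T (p i) = u] and [T (q i) = v]. For [i < j], a common consequence [(c, d)] of
    both ends is thus also a consequence of the three links of the chain
    [T (p i)], [T (p j)], [T (q j)], [T (q i)], and by meet-semidistributivity
    one of them has a common consequence with [(c, d)]. It is not the middle
    one, which is reached from [(a, b)] with [(j - i) * g] letters less than
    [(u, v)]. So [(c, d)] can be replaced by a consequence of itself and of
    [(p i, p j)] or [(q i, q j)]. This is done for all [i < j < k] in turn. *)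
Lemma clique_of_geodesic k g a b s t w w' :
  (rounds (k * k) + rounds (k * k)).+1 <= g -> k * g <= size w ->
  common (k0 + k0) (act w a) (act w b) (act w' s) (act w' t) ->
  (forall n, n < size w + size w' -> ~ joined n a b s t) ->
  exists c d, [/\ c <> d, reach (act w a) (act w b) (rounds (k * k)) c d,
    reach (act w' s) (act w' t) (rounds (k * k)) c d &
    clique k (rounds (k * k) + k * g) c d].
Proof.
move=> hg hw cww' minw.
pose p i := act (drop (i * g) w) a; pose q i := act (drop (i * g) w) b.
suff lower L : size L <= k * k ->
    exists c d, [/\ c <> d, reach (act w a) (act w b) (rounds (size L)) c d,
      reach (act w' s) (act w' t) (rounds (size L)) c d &
      forall i j, i < j < k -> (i, j) \in L ->
        reach (p i) (p j) (rounds (size L) + k * g) c d \/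
        reach (q i) (q j) (rounds (size L) + k * g) c d].
  have [L [sL memL]] := index_pairs k.
  have [c [d [cd wcd w'cd pq]]] := lower L sL.
  have rL : rounds (size L) <= rounds (k * k) by rewrite leq_mul2r !ltnS sL orbT.
  exists c, d; split; [by []|exact: reach_leq wcd|exact: reach_leq w'cd|].
  exists p, q => i j ij; have rLg : rounds (size L) + k * g <= rounds (k * k) + k * g.
    by rewrite leq_add2r.
  by have [h|h] := pq i j ij (memL i j ij); [left|right]; exact: reach_leq h.
elim: L => [_|[i j] L IH sL].
  by have [c [d [cd wcd w'cd]]] := cww'; exists c, d; rewrite /rounds mul2n -addnn.
have [c [d [cd wcd w'cd pq]]] := IH (ltnW sL).
have weaken : rounds (size L) <= rounds (size L).+1 by rewrite roundsS leq_addr.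
have [/andP[ij jk]|nij] := boolP (i < j < k); last first.
  exists c, d; split; [by []|exact: reach_leq wcd|exact: reach_leq w'cd|].
  move=> i' j' ij'; rewrite inE => /predU1P[[ei ej]|/(pq _ _ ij') h].
    by move: nij; rewrite -ei -ej ij'.
  by case: h => h; [left|right]; apply: reach_leq h; rewrite leq_add2r.
set r := rounds (size L) in wcd w'cd pq weaken *.
pose T := act (take (i * g) w).
have Tw x : T (act (drop (i * g) w) x) = act w x by rewrite /T -act_cat cat_take_drop.
(* [(c, d)] is a consequence of the chain that makes a detour by [p j], [q j] *)
pose Q x y := [\/ link (T (p i)) (T (p j)) r x y, link (T (p j)) (T (q j)) r x y |
  link (T (q j)) (T (q i)) r x y].
have Qcd : chain Q c d.
  apply: (chain_map (h := id)) (reach_chain wcd) => x y [h hr]; rewrite -!Tw.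
  have to u v : link u v r (act h u) (act h v) by exists h => //; left.
  have back u v : link u v r (act h v) (act h u) by exists h => //; right.
  case=> -[-> ->].
    apply: (chain_step (y := act h (T (q j)))); last exact: Or33.
    apply: (chain_step (y := act h (T (p j)))); last exact: Or32.
    by apply: chain1; exact: Or31.
  apply: (chain_step (y := act h (T (p j)))); last exact: Or31.
  apply: (chain_step (y := act h (T (q j)))); last exact: Or32.
  by apply: chain1; exact: Or33.
have [x [y [Qxy [c1 [d1 [cd1 xycd1 cdcd1]]]]]] := common_link VA cd Qcd.
have link_reach u v : link u v r x y -> reach u v (r + k0) c1 d1.
  move=> [h hr xy]; apply: reach_comp xycd1; apply: (reach_leq hr).
  by case: xy => -[-> ->]; [exact: reach_act|exact/reach_swap/reach_act].
have Ti : size (take (i * g) w) <= i * g by rewrite size_take_min geq_minl.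
have ikg : i * g <= k * g by rewrite leq_mul2r (ltnW (ltn_trans ij jk)) orbT.
have pull u v : reach (T u) (T v) (r + k0) c1 d1 ->
    reach u v (rounds (size L).+1 + k * g) c1 d1.
  move=> /reach_of_act; apply: reach_leq.
  by rewrite roundsS addnC leq_add2l (leq_trans Ti).
exists c1, d1; split=> //=; first by rewrite roundsS; exact: reach_comp cdcd1.
  by rewrite roundsS; exact: reach_comp cdcd1.
move=> i' j' ij'; rewrite inE => /predU1P[[-> ->]|/(pq _ _ ij') h]; last first.
  by case: h => h; [left|right]; apply: reach_leq (reach_comp h cdcd1);
    rewrite roundsS addnAC.
case: Qxy => [/link_reach/pull|[h hr hxy]|/link_reach/pull/reach_swap];
  [by left| |by right].
(* the shortcut [W] skips the letters of [w] between positions [i * g] and [j * g] *)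
pose W := h ++ take (i * g) w ++ drop (j * g) w.
have eW z : act W z = act h (T (act (drop (j * g) w) z)) by rewrite !act_cat.
have Wcd1 : reach (act W a) (act W b) k0 c1 d1.
  by rewrite !eW; case: hxy xycd1 => -[-> ->] // /reach_swap.
have w'cd1 := reach_comp (reach_of_act w'cd) cdcd1.
case: (minw _ _ (joined_of_reach cd1 Wcd1 w'cd1 (leqnn _))).
have rk : r + k0 <= rounds (k * k) by rewrite -roundsS leq_mul2r !ltnS sL orbT.
have jig : i * g + g <= j * g by rewrite -mulSnr leq_mul2r ij orbT.
have jkg : j * g <= k * g by rewrite leq_mul2r (ltnW jk) orbT.
rewrite !size_cat size_drop; lia.
Qed.

Lemma joined_leq m n a b s t : m <= n -> joined m a b s t -> joined n a b s t.
Proof. by move=> mn [w [w' [h c]]]; exists w, w'; split=> //; exact: leq_trans mn. Qed.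

(** One letter changes the least total length by at most one, so along a word
    this length takes all intermediate values. *)
Lemma joined_crossing C w a b s t :
  joined C (act w a) (act w b) s t -> ~ joined C a b s t ->
  exists a' b', ~ joined C a' b' s t /\ joined C.+1 a' b' s t.
Proof.
move=> + nab; elim: w => [//|x w IH] jw.
have [/IH //|njw] := pselect (joined C (act w a) (act w b) s t).
exists (act w a), (act w b); split=> //; case: jw => w1 [w1' [h c]].
exists (rcons w1 x), w1'; split; first by rewrite size_rcons addSn ltnS.
by rewrite -cats1 !act_cat.
Qed.

(** When [s <> t], this says that [(s, t)] generates the monolith. *)
Definition below_all s t : Prop := forall a b, a <> b -> exists n, reach a b n s t.

Lemma below_all_reach s t n c d : below_all s t -> reach s t n c d -> below_all c d.
Proof. by move=> bst stcd a b /bst[m abst]; exists (m + n); exact: reach_comp stcd. Qed.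

End InAlgebra.

(** If [(a, b)] and [(s, t)] are far apart, some pair on the way from [(a, b)]
    to [(s, t)] is at a distance of [(s, t)] chosen beforehand, long enough for
    [clique_of_geodesic] to give a clique, and still a bound for the distance
    from [(s, t)] to this clique. *)
Lemma common_or_clique k : exists H, forall A, V A -> forall s t : A,
  s <> t -> below_all s t -> forall a b, a <> b ->
  exists c d, [/\ c <> d, reach s t H c d & reach a b H c d \/ clique k H c d].
Proof.
(* one of two words of total length above [C] has length at least [k * g] *)
pose g := (rounds (k * k) + rounds (k * k)).+1; pose C := (k * g + k * g)%N.
pose H := (C.+1 + (k0 + k0) + (rounds (k * k) + k * g))%N; exists H.
move=> A VA s t st bst a b ab.
have [[w [w' [wC [c [d [cd /reach_of_act wcd /reach_of_act w'cd]]]]]]|far] :=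
    pselect (joined C a b s t).
  exists c, d; split=> //; first by apply: reach_leq w'cd; rewrite /H; lia.
  by left; apply: reach_leq wcd; rewrite /H; lia.
have [n /(reach_common_act VA st)[w _ cw]] := bst a b ab.
have near : joined C (act w a) (act w b) s t.
  exists [::], [::]; split=> //=; case: cw => c [d [cd h1 h2]].
  by exists c, d; split=> //; apply: reach_leq (leq_addr _ _) _.
have {w cw near far}[a' [b' [far [w [w' [wC cww']]]]]] := joined_crossing near far.
have Cw : C < size w + size w'.
  by rewrite ltnNge; apply/negP => wC'; apply: far; exists w, w'.
have minw n' : n' < size w + size w' -> ~ joined n' a' b' s t.
  move=> n'w h; apply/far/(joined_leq _ h); lia.
have [hw|hw] := leqP (k * g) (size w).
  have [c [d [cd _ w'cd cl]]] := clique_of_geodesic VA (leqnn _) hw cww' minw.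
  exists c, d; split=> //.
    by apply: reach_leq (reach_of_act w'cd); rewrite /H; lia.
  by right; apply: clique_leq cl; rewrite /H; lia.
have hw' : k * g <= size w' by rewrite /C in Cw; lia.
have minw' n' : n' < size w' + size w -> ~ joined n' s t a' b'.
  by rewrite addnC => /minw nj /joined_sym.
have [c [d [cd w'cd _ cl]]] :=
  clique_of_geodesic VA (leqnn _) hw' (common_sym cww') minw'.
exists c, d; split=> //.
  by apply: reach_leq (reach_of_act w'cd); rewrite /H; lia.
by right; apply: clique_leq cl; rewrite /H; lia.
Qed.

Definition distinct (A : algebra S) k (y : nat -> A) : Prop :=
  forall i j, i < j < k -> y i <> y j.

Lemma clique_near k : exists H, forall A, V A -> forall (s t : A) (y : nat -> A),
  s <> t -> below_all s t -> distinct k y ->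
  exists c d, [/\ c <> d, reach s t H c d & clique k H c d].
Proof.
have [H hH] := common_or_clique k; exists (k * k * H)%N => A VA s t y st bst yk.
have [L [sL memL]] := index_pairs k.
suff [c [d [cd stcd clc]]] : exists c d, [/\ c <> d, reach s t (size L * H) c d &
    clique k (size L * H) c d \/ forall i j, i < j < k -> (i, j) \in L ->
      reach (y i) (y j) (size L * H) c d].
  have LH : size L * H <= k * k * H by rewrite leq_mul2r sL orbT.
  exists c, d; split; [by []|exact: reach_leq stcd|].
  case: clc => [|all]; first exact: clique_leq.
  by exists y, y => i j ij; left; apply: reach_leq (all i j ij (memL i j ij)).
elim: L {sL memL} => [|[i j] L [c [d [cd stcd clc]]]].
  by exists s, t; split=> //; [exact: reach_gen|right].
rewrite /= mulSn addnC; have LH : size L * H <= size L * H + H by exact: leq_addr.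
case: clc => [cl|all].
  exists c, d; split; [by []|exact: reach_leq stcd|left; exact: clique_leq cl].
have [ij|nij] := boolP (i < j < k); last first.
  exists c, d; split; [by []|exact: reach_leq stcd|right => i' j' ij'].
  rewrite inE => /predU1P[[ei ej]|/(all _ _ ij')]; last exact: reach_leq.
  by move: nij; rewrite -ei -ej ij'.
have [c' [d' [cd' cdcd' h]]] :=
  hH A VA c d cd (below_all_reach bst stcd) _ _ (yk i j ij).
exists c', d'; split; [by []|exact: reach_comp cdcd'|].
case: h => [ijcd'|cl]; [right => i' j' ij'|left].
  rewrite inE => /predU1P[[-> ->]|/(all _ _ ij') h]; last exact: reach_comp cdcd'.
  exact: reach_leq (leq_addl _ _) ijcd'.
exact: clique_leq (leq_addl _ _) cl.
Qed.

(** Cliques of all sizes at once, within a number of rounds that depends on the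
    size of the clique but not on [n]. The order of construction matters: the
    largest clique is found first, since passing to a lower pair afterwards
    costs a clique of size [j] only the [H i] with [i <= j]. *)
Lemma cliques_of_all_sizes : exists G, forall n A, V A ->
  forall (s t : A) (y : nat -> A),
  s <> t -> below_all s t -> distinct n y ->
  exists c d : A, c <> d /\ forall j, j <= n -> clique j (G j) c d.
Proof.
have [H hH] := choice clique_near; pose G n := \sum_(i < n.+1) H i; exists G.
move=> n A VA s t y st bst yn.
suff [c [d [cd _ cl]]] : exists c d : A, [/\ c <> d, reach s t (G n) c d &
    forall j, j <= n -> clique j (G j) c d] by exists c, d.
elim: n s t st bst yn => [|n IH] s t st bst yn.
  exists s, t; split=> //; first by apply: (reach_leq (k := 0)) => //; exact: reach_gen.
  move=> j; rewrite leqn0 => /eqP ->; exists (fun=> s), (fun=> s) => i j'.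
  by rewrite ltn0 andbF.
have [s1 [t1 [st1 sst1 cl1]]] := hH n.+1 A VA s t y st bst yn.
have yn' : distinct n y by move=> i j /andP[ij jn]; apply: yn; rewrite ij ltnW.
have [c [d [cd s1cd cl]]] := IH s1 t1 st1 (below_all_reach bst sst1) yn'.
have GS : G n.+1 = H n.+1 + G n by rewrite /G big_ord_recr addnC.
exists c, d; split=> //; first by rewrite GS; exact: reach_comp s1cd.
move=> j; rewrite leq_eqVlt => /predU1P[->|/cl //].
by rewrite GS; exact: clique_reach s1cd.
Qed.

End Cliques.

(** * An infinite subdirectly irreducible algebra *)

Section InfiniteSI.
Variable S : signature.

Lemma si_monolith (A : algebra S) : subdirectly_irreducible A ->
  exists s t : A, s <> t /\ below_all s t.
Proof.
move=> siA; apply: contrapT => nomono.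
pose I := {p : A * A | p.1 <> p.2}.
have [|[[a b] /= ab] /(_ a b) cg_ab] := si_trivial_congruence
    (th := fun i : I => cg (sval i).1 (sval i).2) siA.
  move=> s t st; apply: contrapT => nst; apply: nomono; exists s, t; split=> //.
  by move=> a b ab; exact: (st (exist _ (a, b) ab)).
by apply/ab/cg_ab; exists 0; exact: reach_gen.
Qed.

Lemma finite_index (A : Type) : finite_set [set: A] ->
  exists m (e : A -> nat), injective e /\ forall x, e x < m.
Proof.
move=> /finite_enum[s hs].
have [e he] := choice (fun x => List.In_nth_error s x (proj1 (hs x) Logic.I)).
exists (length s), e; split=> [x y exy|x].
  by have := he x; rewrite exy he => -[].
by apply/ltP/List.nth_error_Some; rewrite he.
Qed.

(** The members of the clique stay distinct in the square of the quotient. *)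
Lemma clique_quotient (A : algebra S) (th : congruence A) c d k h m
    (e : quot_alg th -> nat) :
  injective e -> (forall x, e x < m) -> ~ th c d -> clique k h c d -> k <= m * m.
Proof.
move=> ei em ncd [p [q pq]].
pose f i := (e (quot_class th (p i)) * m + e (quot_class th (q i)))%N.
have m0 : 0 < m by exact: leq_ltn_trans (em (quot_class th c)).
have fi i j : f i = f j -> th (p i) (p j) /\ th (q i) (q j).
  move=> fij; split; apply/quot_classP/ei.
    by have := congr1 (divn^~ m) fij; rewrite !divnMDl // !divn_small // !addn0.
  by have := congr1 (modn^~ m) fij; rewrite !modnMDl !modn_small.
have fm i : f i < m * m.
  by move: (em (quot_class th (p i))) (em (quot_class th (q i))); rewrite /f; nia.
have f_lt i j : i < j < k -> f i <> f j.
  move=> /pq h' /fi[pij qij]; apply: ncd.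
  by case: h' => h'; apply: reach_cong h'.
pose F (i : 'I_k) : 'I_(m * m) := Ordinal (fm i).
rewrite -[k]card_ord -[X in _ <= X]card_ord; apply: (@leq_card _ _ F) => i j.
move=> /(congr1 val) /= fij; apply: val_inj.
case: (ltngtP i j) => // ij; exfalso.
  by apply: (f_lt i j) fij; rewrite ij ltn_ord.
by apply: (f_lt j i) (esym fij); rewrite ij ltn_ord.
Qed.

(** The cliques survive in an ultraproduct of larger and larger subdirectly
    irreducible algebras, and then in a quotient. *)
Lemma infinite_si (V : algebra S -> Prop) : finite_type S -> variety V ->
  congruence_meet_semidistributive V ->
  (forall n, exists A, [/\ V A, subdirectly_irreducible A &
     exists y : nat -> A, distinct n y]) ->
  exists B, [/\ V B, subdirectly_irreducible B & ~ finite_algebra B].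
Proof.
move=> fin vV sdV large; have [k0 hk0] := chain_common_link vV sdV.
have [G hG] := cliques_of_all_sizes hk0.
have [n|B hB] := @choice_dep nat (fun=> algebra S) (fun n A => V A /\
    exists cd : A * A, cd.1 <> cd.2 /\ forall j, j <= n -> clique j (G j) cd.1 cd.2).
  have [A [VA siA [y yn]]] := large n; exists A; split=> //.
  have [s [t [st bst]]] := si_monolith siA.
  by have [c [d cd]] := hG n A VA s t y st bst yn; exists (c, d).
have [cd hcd] := choice_dep (fun n => proj2 (hB n)).
have [U [UU evU]] := @ultraFilterLemma nat eventually eventually_filter.
have FU : Filter U by exact: (@filter_filter _ _ ultra_proper).
pose lim (x : forall n, B n) := @limit S U FU B x.
pose c n := (cd n).1; pose d n := (cd n).2.
have cliqueU j : clique j (G j) (lim c) (lim d).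
  have [n|pq hpq] := @choice_dep nat (fun n => (nat -> B n) * (nat -> B n))%type
      (fun n pq => j <= n -> forall i i', i < i' < j ->
        reach (pq.1 i) (pq.1 i') (G j) (c n) (d n) \/
        reach (pq.2 i) (pq.2 i') (G j) (c n) (d n)).
    have [jn|nj] := pselect (j <= n); last by exists (fun=> c n, fun=> c n).
    by have [p [q pq]] := proj2 (hcd n) j jn; exists (p, q).
  exists (fun i => lim (fun n => (pq n).1 i)), (fun i => lim (fun n => (pq n).2 i)).
  move=> i i' ii'.
  have Uj : U [set n | j <= n] by apply: evU; exists j.
  case: (in_ultra_setVsetC
    [set n | reach ((pq n).1 i) ((pq n).1 i') (G j) (c n) (d n)] UU) => h.
    by left; exact: reach_limit h.
  right; apply: reach_limit => //.
  by apply: (filterS _ (filterI Uj h)) => n [/= jn nh]; case: (hpq n jn i i' ii').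
have ncd : lim c <> lim d.
  move=> /limitP ecd; apply: (@filter_not_empty _ U ultra_proper).
  by apply: (filterS _ ecd) => n /= e; case: (proj1 (hcd n)).
have [th [thcd sith]] := si_quotient_separating ncd.
exists (quot_alg th); split=> //.
  by apply: variety_quot => //; apply: variety_reduced => // n; case: (hB n).
move=> /finite_index[m [e [ei em]]].
by have := clique_quotient ei em thcd (cliqueU (m * m).+1); rewrite ltnn.
Qed.

End InfiniteSI.

(** * Finite residual bound and strong structural completeness *)

Section Main.
Variables (S : signature) (V : algebra S -> Prop).

Lemma isomorphic_sym (A B : algebra S) : isomorphic A B -> isomorphic B A.
Proof.
move=> [h hh [g hK gK]]; exists g; last by exists h.
move=> f b; apply: (can_inj hK); rewrite gK hh; congr op.
by apply/funext => k; rewrite gK.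
Qed.

Definition residually_finite (A : algebra S) : Prop := forall x y : A, x <> y ->
  exists (B : algebra S) (h : A -> B), [/\ finite_algebra B, is_hom h & h x <> h y].

Lemma residually_finite_prevariety : prevariety residually_finite.
Proof.
split.
- move=> A B /isomorphic_sym[g gh [h gK hK]] rA x y xy.
  have [C [f [finC fh fxy]]] := rA (g x) (g y) (fun e => xy (can_inj gK e)).
  by exists C, (fun z => f (g z)); split=> //; exact: hom_comp.
- move=> A U rA x y xy.
  have [C [f [finC fh fxy]]] := rA (sval x) (sval y) (fun e => xy (sig_inj e)).
  exists C, (fun z => f (sval z)); split=> //.
  exact: (hom_comp fh (@sub_op_hom _ A U)).
- move=> I B rB x y xy.
  have /existsNP[i xyi] : ~ forall i, x i = y i.
    by move=> e; apply/xy/functional_extensionality_dep.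
  have [C [f [finC fh fxy]]] := rB i _ _ xyi.
  by exists C, (fun z => f (z i)); split=> //; exact: (hom_comp fh (@hom_proj _ _ B i)).
Qed.

(** An identity failing in [V] fails in one of the finite algebras that generate
    [V], under a valuation that extends to a homomorphism from the free
    algebra. *)
Lemma free_alg_residually_finite :
  generated_by_finite_algebras V -> residually_finite (free_alg V).
Proof.
move=> [K [finK VK]] c d cd; pose s := free_repr c; pose t := free_repr d.
have [[B [KB [v vst]]]|nB] := pselect (exists B, K B /\ exists v : nat -> B,
    eval v s <> eval v t).
  have VB : V B by apply/VK => C _; exact.
  by exists B, (free_ext v); split; [exact: finK|exact: free_ext_hom|].
case: cd; rewrite -(free_reprK c) -(free_reprK d); apply/free_classP => A /VK VA.
apply: (VA (fun B => sat_identity B (s, t))).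
  by exists (fun e => e = (s, t)) => B; split=> [h e -> //|]; apply.
by move=> B KB v; apply: contrapT => vst; apply: nB; exists B; split=> //; exists v.
Qed.

Lemma finite_inj (A B : Type) (h : A -> B) : injective h ->
  finite_set [set: B] -> finite_set [set: A].
Proof.
move=> hi finB; have -> : [set: A] = h @^-1` [set: B] by [].
by apply: finite_preimage finB => x y _ _; exact: hi.
Qed.

Lemma si_finite (A : algebra S) : generated_by_finite_algebras V ->
  strongly_structurally_complete V -> V A -> subdirectly_irreducible A ->
  finite_algebra A.
Proof.
move=> gV ssc /ssc PA siA.
have rA : residually_finite A.
  apply: PA => [|B ->]; first exact: residually_finite_prevariety.
  exact: free_alg_residually_finite.
have [Bh hBh] := choice_dep (fun i : {p : A * A | p.1 <> p.2} => rA _ _ (svalP i)).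
have [h hP] := choice_dep hBh.
have [x y xyi|i hi] := si_trivial_congruence
    (th := fun i => ker_cong (let: And3 _ hh _ := hP i in hh)) siA.
  apply: contrapT => nxy; pose i : {p : A * A | p.1 <> p.2} := exist _ (x, y) nxy.
  by have [_ _] := hP i; apply; exact: (xyi i).
by have [finB _ _] := hP i; apply: finite_inj finB; exact: hi.
Qed.

Lemma card_or_distinct (A : algebra S) m :
  (exists2 n, n < m & [set: A] #= `I_n) \/ exists y : nat -> A, distinct m y.
Proof.
elim: m => [|m [[n nm An]|[y ym]]].
- right; case: (carrier_nonempty A) => x; exists (fun=> x) => i j.
  by rewrite ltn0 andbF.
- by left; exists n => //; exact: ltnW.
have [[x xy]|nx] := pselect (exists x, forall i, i < m -> y i <> x).
  right; exists (fun i => if i < m then y i else x) => i j /andP[ij].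
  rewrite ltnS leq_eqVlt => /predU1P[jm|jm] /=.
    by rewrite jm ltnn -jm ij; apply: xy; rewrite -jm.
  by rewrite jm (ltn_trans ij jm); apply: ym; rewrite ij.
left; exists m => //; have -> : [set: A] = y @` `I_m.
  apply/seteqP; split=> // x _; apply: contrapT => nyx; apply: nx.
  by exists x => i im e; apply: nyx; exists i.
apply: inj_card_eq => i j; rewrite !inE /= => im jm yij.
by case: (ltngtP i j) => // ij; exfalso; [apply: (ym i j)|apply: (ym j i)];
  rewrite ?ij ?yij.
Qed.

(** A finite algebra of finite type has a finite diagram. If all homomorphisms
    to the free algebra identified [a] and [b], the quasi-identity from the
    diagram to the equality of [a] and [b] would hold in the free algebra,
    hence in [B]. *)
Lemma finite_separated (B : algebra S) (a b : B) : finite_type S ->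
  structurally_complete V -> V B -> finite_algebra B -> a <> b ->
  exists h : B -> free_alg V, is_hom h /\ h a <> h b.
Proof.
move=> finS sc /sc QB /finite_index[m [e [ei em]]] ab.
(* elements of [B] are named by variables through [e], with inverse [g] *)
have [n|g hg] := @choice nat B (fun n y => forall x, e x = n -> x = y).
  have [[x xn]|nx] := pselect (exists x, e x = n).
    by exists x => x'; rewrite -xn => /ei.
  by exists a => x xn; case: nx; exists x.
have gK x : g (e x) = x by rewrite -(hg (e x) x).
pose diag (f : S) (xs : 'I_(arity f) -> B) : identity S :=
  (App (fun k => Var S (e (xs k))), Var S (e (op B f xs))).
have [s hs] : exists s : seq (identity S),
    forall q, List.In q s <-> exists f xs, q = diag f xs.
  have fin : finite_set (\bigcup_(f in [set: S]) range (diag f)).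
    apply: bigcup_finite => // f _; apply: finite_image.
    pose of_ffun (phi : {ffun 'I_(arity f) -> 'I_m}) k := g (phi k).
    have -> : [set: 'I_(arity f) -> B] = range of_ffun.
      apply/seteqP; split=> // xs _; exists [ffun k => Ordinal (em (xs k))] => //.
      by apply/funext => k; rewrite /of_ffun ffunE /= gK.
    exact/finite_image/finite_finset.
  have [s hs] := finite_enum fin; exists s => q; rewrite -hs.
  by split=> [[f _ [xs _ <-]]|[f [xs ->]]]; exists f => //; exists xs.
have [Fq|nFq] := pselect
    (sat_quasi_identity (free_alg V) (s, (Var S (e a), Var S (e b)))).
  case: ab; rewrite -(gK a) -(gK b).
  apply: (QB (fun A => sat_quasi_identity A (s, (Var S (e a), Var S (e b))))).
  - exists (fun q => q = (s, (Var S (e a), Var S (e b)))) => A.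
    by split=> [h q -> //|]; apply.
  - by move=> _ ->.
  move=> q /hs[f [xs ->]]; rewrite /sat_at /= gK; congr op.
  by apply/funext => k; rewrite gK.
have /existsNP[v /not_implyP[vs vab]] := nFq.
exists (fun x => v (e x)); split=> // f xs.
by have := vs (diag f xs); rewrite /sat_at /= => <- //; apply/hs; exists f, xs.
Qed.

Lemma prevariety_of_separated (F A : algebra S) :
  (forall x y : A, x <> y -> exists h : A -> F, is_hom h /\ h x <> h y) ->
  prevariety_of (fun B => B = F) A.
Proof.
move=> sep C [Ciso Csub Cprod] CF.
pose I := {p : A * A | p.1 <> p.2}.
have [h hP] := choice (fun i : I => sep _ _ (svalP i)).
pose em (x : A) : prod_alg (fun _ : I => F) := fun i => h i x.
have emh : is_hom em.
  by move=> f a; apply: functional_extensionality_dep => i; exact: (proj1 (hP i)).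
have emi : injective em.
  move=> x y exy; apply: contrapT => xy.
  by apply: (proj2 (hP (exist _ (x, y) xy))); exact: (congr1 (fun z => z _) exy).
have im_op f (a : 'I_(arity f) -> prod_alg (fun _ : I => F)) :
    (forall k, exists x, em x = a k) -> exists x, em x = op _ f a.
  move=> /choice[x hx]; exists (op A f x); rewrite emh; congr op.
  by apply/funext => k; exact: hx.
have im0 : exists z, exists x, em x = z.
  by case: (carrier_nonempty A) => x; exists (em x), x.
pose U := Subuniverse im_op im0.
apply: (Ciso (subalg U)); last by apply/Csub/Cprod => i; exact: CF.
apply: isomorphic_sym.
exists (fun x => exist _ (em x) (ex_intro _ x erefl) : subalg U).
  by move=> f a; apply: sig_inj; exact: emh.
have [g hg] := choice (fun z : subalg U => svalP z).
exists g => [x|z]; first by apply: emi; rewrite hg.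
by apply: sig_inj; exact: hg.
Qed.

End Main.

Theorem theorem3p5 (S : signature) (V : algebra S -> Prop) :
  finite_type S ->
  variety V ->
  generated_by_finite_algebras V ->
  congruence_meet_semidistributive V ->
  structurally_complete V ->
  (strongly_structurally_complete V <-> has_finite_residual_bound V).
Proof.
move=> finS vV gV sdV sc; split=> [ssc|[m hm]].
  apply: contrapT => /forallNP nobound.
  have [n|B [VB siB nfinB]] := infinite_si finS vV sdV; last first.
    exact/nfinB/(si_finite gV ssc).
  have /existsNP[A /not_implyP[VA /not_implyP[siA nA]]] := nobound n.
  by exists A; split=> //; case: (card_or_distinct A n).
move=> A; split=> [VA|PA]; last first.
  by apply: PA => [|B ->]; [exact: variety_prevariety|exact: free_alg_variety].
apply: prevariety_of_separated => x y /si_quotient_separating[th [nxy sith]].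
have Vth := variety_quot th vV VA; have [n _ cardn] := hm _ Vth sith.
have finth : finite_algebra (quot_alg th) by apply/finite_setP; exists n.
have [h [hh hxy]] := finite_separated finS sc Vth finth
  (fun e => nxy (proj1 (quot_classP th x y) e)).
exists (fun z => h (quot_class th z)); split=> //.
exact: (hom_comp hh (@quot_hom _ _ th)).
Qed.
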